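(* In the setting described in the context, let $\kappa,\tau>0$, let $\Sigma_\rho$ be a positive diagonal operator on $X$, let $(\eta_*,0)$ be a synchronous target with $f_*:=f(\eta_* )$ and $p=Bf_*$, and assume $P_H^{\Sigma_\rho}f_*=0$. Consider the system $$\dot\eta=B^\top\omega-\frac{\kappa}{\tau}\Sigma_\rho^{-1}P_H^{\Sigma_\rho}\bigl(f(\eta)-f_*\bigr),\qquad M\dot\omega+D\omega=p-Bf(\eta).$$ Assume that $(\eta_*,0)$ is angle-cohesive, i.e. for some $0<\gamma<\pi/2$ one has $|\operatorname{pr}(\eta_{*,e})|\le\gamma$ for all $e\in E$, and that a solution $(\eta,\omega)$ of this system remains in a compact forward-invariant subset of $$\mathcal{D}\times\mathbb{R}^n,\qquad \mathcal{D}=\{\eta\in X:\ |\eta_e|<\pi/2\text{ for all }e\in E\}.$$ Then the Bregman swing energy $$V(\eta,\omega)=\tfrac12\omega^\top M\omega+U(\eta)-U(\eta_* )-f_*^\top(\eta-\eta_* ),\qquad U(\eta)=\sum_{e\in E}a_e(1-\cos\eta_e),$$ satisfies $$\dot V=-\omega^\top D\omega-\frac{\kappa}{\tau}\bigl\|P_H^{\Sigma_\rho}\bigl(f(\eta)-f_*\bigr)\bigr\|_{\Sigma_\rho^{-1}}^2\le0 .$$ Consequently, every such trajectory converges to the largest invariant set on the effective state space (the space of the variables $(\eta,\omega)$), on which $$\omega=0,\qquad P_H^{\Sigma_\rho}\bigl(f(\eta)-f_*\bigr)=0 .$$ On this invariant set one also has $Bf(\eta)=p$. The last two equations, $P_H^{\Sigma_\rho}(f(\eta)-f_*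 )=0$ and $Bf(\eta)=p$, together with $Bf_*=p$, imply $f(\eta)=f_*$. Since the componentwise sine law is injective on $\mathcal{D}$, the invariant set in $(\eta,\omega)$-coordinates is the single point $(\eta_*,0)$. Hence, as $t\to\infty$, $$f(\eta(t))\to f_*,\qquad \eta(t)\to\eta_*,\qquad \omega(t)\to0 .$$ These conclusions concern the effective edge phase $\eta=B^\top\theta+u$ and the line-flow output. Without additional constraints they do not determine the bus phase $\theta$ and the line-actuator variable $u$ separately: limiting pairs $(\theta,u)$ lie in the fibre $B^\top\theta+u=\eta_*$, and the uniform phase shift of $\theta$ remains a gauge symmetry.
   Context: $G$ is a finite connected graph with $n$ vertices and edge set $E$, with a fixed reference orientation of each edge, edge space $X=\mathbb{R}^E$, and incidence operator $B:X\to\mathbb{R}^n$ whose column for each oriented edge has entry $+1$ at the tail and $-1$ at the head. $M,D$ are positive diagonal operators on $\mathbb{R}^n$, $a_e>0$ for all $e\in E$, and $f(\eta)=\operatorname{diag}(a)\sin\eta$ (componentwise sine). $\operatorname{pr}:\mathbb{R}\to[-\pi,\pi)$ is the principal representative modulo $2\pi$, $\operatorname{pr}(x)=x-2\pi\lfloor (x+\pi)/(2\pi)\rfloor$. $P_H^{\Sigma_\rho}$ denotes the projection of $X$ onto $\ker B$ that is orthogonal for the inner product $\langle x,y\rangle_{\Sigma_\rho^{-1}}=x^\top\Sigma_\rho^{-1}y$, with norm $\|\cdot\|_{\Sigma_\rho^{-1}}$. The system in the claim is obtained by passing to the effective variables $(\eta,\omega)$, $\eta=B^\top\theta+u$, in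 the full closed loop $\dot\theta=\omega$, $M\dot\omega=p-D\omega-Bf(B^\top\theta+u)$, $\tau\dot u=-\kappa\Sigma_\rho^{-1}P_H^{\Sigma_\rho}(f(B^\top\theta+u)-f_* )$, where $\theta\in\mathbb{R}^n$ is the vector of bus phases, $\omega\in\mathbb{R}^n$ the vector of frequency deviations, and $u\in X$ the line-actuator variable. $\dot V$ denotes the derivative of $t\mapsto V(\eta(t),\omega(t))$ along a classical trajectory.
   Formalization: Angle cohesion fixes η_* only modulo 2π (single edge, η_*=2π, η≡0 refutes η→η_* ), so the limit, the single invariant point in D and the fibre are stated with pr(η_* ) in place of η_*; when η_* lies in D, pr(η_* )=η_* and the claim is literal. *)

(* Defs.v *)
From HB Require Import structures.
From mathcomp Require Import all_boot all_order all_algebra.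
From mathcomp Require Import all_classical all_reals all_analysis.
Import numFieldNormedType.Exports.
Import Order.TTheory GRing.Theory Num.Theory.

Set Implicit Arguments.
Unset Strict Implicit.
Unset Printing Implicit Defensive.

Local Open Scope classical_set_scope.
Local Open Scope ring_scope.

(* A graph with n vertices and m oriented edges: edge e runs from tail e to
   head e.  Parallel edges are allowed, loops are not (a loop would have no
   incidence column with one entry +1 and one entry -1). *)
Definition adjacent n m (tail head : 'I_m -> 'I_n) : rel 'I_n :=
  fun i j => [exists e, (tail e == i) && (head e == j)
                     || (tail e == j) && (head e == i)].

Definition connected_graph n m (tail head : 'I_m -> 'I_n) : Prop :=
  [/\ (0 < n)%N, forall e, tail e != head e &
      forall i j, connect (adjacent tail head) i j].

Definition incidence (R : realType) n m (tail head : 'I_m -> 'I_n) :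
    'M[R]_(n, m) :=
  \matrix_(i, e) ((i == tail e)%:R - (i == head e)%:R).

Definition posdiag (R : realType) k (A : 'M[R]_k) : Prop :=
  is_diag_mx A /\ forall i, 0 < A i i.

Definition flow (R : realType) m (a : 'rV[R]_m) (eta : 'cV[R]_m) : 'cV[R]_m :=
  diag_mx a *m map_mx (@sin R) eta.

Definition pr (R : realType) (x : R) : R :=
  x - 2 * pi * (Num.floor ((x + pi) / (2 * pi)))%:~R.

Definition prv (R : realType) m (eta : 'cV[R]_m) : 'cV[R]_m :=
  map_mx (@pr R) eta.

Definition phase_domain (R : realType) m : set 'cV[R]_m :=
  [set eta | forall e, `|eta e 0| < pi / 2].

Definition bilin (R : realType) k (A : 'M[R]_k) (x y : 'cV[R]_k) : R :=
  (x^T *m A *m y) 0 0.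

Definition wnorm (R : realType) m (S : 'M[R]_m) (x : 'cV[R]_m) : R :=
  Num.sqrt (bilin (invmx S) x x).

(* [proj_mx U V] is the projection onto the row space of U parallel to that of
   V.  Here U spans {x^T | B x = 0} and V spans {y^T | y^T S^-1 x = 0 for all
   x in ker B}; the outer transpose makes the operator act on columns. *)
Definition ker_proj (R : realType) n m (B : 'M[R]_(n, m)) (S : 'M[R]_m) :
    'M[R]_m :=
  let N := kermx B^T in (proj_mx N (kermx (invmx S *m N^T)))^T.

Lemma posdiag_invmx (R : realType) k (S : 'M[R]_k) : posdiag S ->
  S \in unitmx /\ posdiag (invmx S).
Proof.
case=> /diag_mxP[d ->] dpos.
have {}dpos i : 0 < d 0 i by have := dpos i; rewrite !mxE eqxx.
have e : diag_mx d *m diag_mx (\row_i (d 0 i)^-1) = 1%:M.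
  rewrite mulmx_diag; apply/matrixP=> i j; rewrite !mxE.
  by rewrite divff // gt_eqF.
have [u _] := mulmx1_unit e.
split=> //; have -> : invmx (diag_mx d) = diag_mx (\row_i (d 0 i)^-1).
  by rewrite -[LHS]mulmx1 -e mulKmx.
split; first exact: diag_mx_is_diag.
by move=> i; rewrite !mxE eqxx mulr1n invr_gt0.
Qed.

Lemma posdiag_definite (R : realType) k (A : 'M[R]_k) (x : 'cV[R]_k) :
  posdiag A -> bilin A x x = 0 -> x = 0.
Proof.
case=> /diag_mxP[d ->] dpos.
have {}dpos i : 0 < d 0 i by have := dpos i; rewrite !mxE eqxx.
rewrite /bilin mul_mx_diag mxE => /psumr_eq0P h.
apply/matrixP=> i j; rewrite ord1 [RHS]mxE.
have /h/(_ i isT) : forall i, true ->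
    0 <= (\matrix_(i0, j0) (x^T i0 j0 * d 0 j0)) 0 i * x i 0.
  move=> l _; rewrite !mxE mulrAC -expr2.
  by rewrite mulr_ge0 ?sqr_ge0 // ltW.
by rewrite !mxE mulrAC => /eqP; rewrite !mulf_eq0 (gt_eqF (dpos i)) orbF orbb
  => /eqP.
Qed.

(* [ker_proj B S] is the S^-1-orthogonal projection onto ker B. *)
Lemma ker_projP (R : realType) n m (B : 'M[R]_(n, m)) (S : 'M[R]_m)
    (x : 'cV[R]_m) : posdiag S ->
  [/\ B *m (ker_proj B S *m x) = 0,
      B *m x = 0 -> ker_proj B S *m x = x &
      forall y, B *m y = 0 ->
        bilin (invmx S) (x - ker_proj B S *m x) y = 0].
Proof.
move=> /posdiag_invmx[_ Spos].
rewrite /ker_proj; set N := kermx B^T; set W := kermx _.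
have NP (y : 'cV[R]_m) : (B *m y = 0) <-> (y^T <= N)%MS.
  split=> [h|/sub_kermxP h]; first by apply/sub_kermxP; rewrite -trmx_mul h trmx0.
  by apply: trmx_inj; rewrite trmx_mul h trmx0.
have WP (w : 'rV[R]_m) y : (w <= W)%MS -> (y^T <= N)%MS ->
    w *m invmx S *m y = 0.
  move=> /sub_kermxP h /submxP[c hc].
  by rewrite -[y]trmxK hc trmx_mul mulmxA -[_ *m _ *m N^T]mulmxA h mul0mx.
have NW0 : (N :&: W)%MS = 0.
  apply/eqP; rewrite -submx0; apply/rV_subP=> v; rewrite sub_capmx.
  case/andP=> vN vW; suff -> : v = 0 by exact: sub0mx.
  apply: trmx_inj; rewrite trmx0; apply: (posdiag_definite Spos).
  by rewrite /bilin trmxK WP ?mxE // trmxK.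
have full (v : 'rV[R]_m) : (v <= N + W)%MS.
  suff : row_full (N + W)%MS by exact: submx_full.
  have := mxrank_sum_cap N W; rewrite NW0 mxrank0 addn0 /row_full => ->.
  rewrite eqn_leq -{1}(mxrank_sum_cap N W) NW0 mxrank0 addn0 rank_leq_col /=.
  rewrite [X in (_ + X)%N]mxrank_ker -leq_subLR leq_sub2l //.
  by rewrite -[X in (_ <= X)%N]mxrank_tr mxrankM_maxr.
have tP : ((proj_mx N W)^T *m x)^T = x^T *m proj_mx N W.
  by rewrite trmx_mul trmxK.
split.
- by apply/NP; rewrite tP proj_mx_sub.
- by move=> /NP h; apply: trmx_inj; rewrite tP proj_mx_id.
- move=> y /NP h; rewrite /bilin WP ?mxE //.
  by rewrite linearB /= tP proj_mx_compl_sub.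
Qed.

(* Derivative relative to the time set I: two-sided at interior points of I,
   one-sided at an endpoint. *)
Definition derivative_within (R : realType) (V : normedModType R) (I : set R)
    (g : R -> V) (t : R) (v : V) : Prop :=
  h^-1 *: (g (h + t) - g t) @[h --> within [set h | I (h + t)] 0^'] --> v.

(* Classical solutions on the time set I; a state is z = (eta, omega). *)
Definition swing_solution (R : realType) n m (B : 'M[R]_(n, m)) (M D : 'M[R]_n)
    (a : 'rV[R]_m) (p : 'cV[R]_n) (S : 'M[R]_m) (kappa tau : R)
    (fs : 'cV[R]_m) (I : set R) (z : R -> 'cV[R]_m * 'cV[R]_n) : Prop :=
  forall t, I t ->
    derivative_within I (fun s => (z s).1) t
      (B^T *m (z t).2 -
       (kappa / tau) *:
         (invmx S *m (ker_proj B S *m (flow a (z t).1 - fs)))) /\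
    exists2 domega : 'cV[R]_n,
      derivative_within I (fun s => (z s).2) t domega &
      M *m domega + D *m (z t).2 = p - B *m flow a (z t).1.

Definition effective_phase (R : realType) n m (B : 'M[R]_(n, m))
    (theta : 'cV[R]_n) (u : 'cV[R]_m) : 'cV[R]_m := B^T *m theta + u.

Definition closed_loop_solution (R : realType) n m (B : 'M[R]_(n, m))
    (M D : 'M[R]_n) (a : 'rV[R]_m) (p : 'cV[R]_n) (S : 'M[R]_m) (kappa tau : R)
    (fs : 'cV[R]_m) (I : set R) (theta omega : R -> 'cV[R]_n)
    (u : R -> 'cV[R]_m) : Prop :=
  forall t, I t ->
    let f := flow a (effective_phase B (theta t) (u t)) in
    [/\ derivative_within I theta t (omega t),
        exists2 domega : 'cV[R]_n, derivative_within I omega t domega &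
          M *m domega = p - D *m omega t - B *m f &
        exists2 du : 'cV[R]_m, derivative_within I u t du &
          tau *: du = - kappa *: (invmx S *m (ker_proj B S *m (f - fs)))].

Definition potential (R : realType) m (a : 'rV[R]_m) (eta : 'cV[R]_m) : R :=
  \sum_e a 0 e * (1 - cos (eta e 0)).

Definition bregman_energy (R : realType) n m (M : 'M[R]_n) (a : 'rV[R]_m)
    (eta_s fs : 'cV[R]_m) (z : 'cV[R]_m * 'cV[R]_n) : R :=
  2^-1 * bilin M z.2 z.2 + potential a z.1 - potential a eta_s
    - (fs^T *m (z.1 - eta_s)) 0 0.

Notation half_line := (`[0, +oo[%classic) (only parsing).

(* Below, [sol I z] stands for "z is a solution on the time set I". *)
Definition forward_invariant (R : realType) (T : Type)
    (sol : set R -> (R -> T) -> Prop) (K : set T) : Prop :=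
  forall z, sol half_line z -> K (z 0) -> forall t, 0 <= t -> K (z t).

(* Through every point of A passes a solution defined for all times, and all
   such solutions stay in A; global existence is part of the definition so that
   no set is invariant vacuously. *)
Definition invariant_set (R : realType) (T : Type)
    (sol : set R -> (R -> T) -> Prop) (A : set T) : Prop :=
  forall z0, A z0 ->
    (exists2 z, sol setT z & z 0 = z0) /\
    (forall z, sol setT z -> z 0 = z0 -> forall t, A (z t)).

Definition largest_invariant (R : realType) (T : Type)
    (sol : set R -> (R -> T) -> Prop) (A : set T) : set T :=
  \bigcup_(C in [set C | invariant_set sol C /\ C `<=` A]) C.

Lemma largest_invariantP (R : realType) (T : Type)
    (sol : set R -> (R -> T) -> Prop) (A : set T) :
  [/\ invariant_set sol (largest_invariant sol A),
      largest_invariant sol A `<=` A &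
      forall C, invariant_set sol C -> C `<=` A ->
        C `<=` largest_invariant sol A].
Proof.
split.
- move=> z0 [C [Cinv CA] Cz0]; have [ex st] := Cinv _ Cz0.
  by split=> // z sz ez t; exists C => //; exact: st.
- by move=> z0 [C [_ CA] /CA].
- by move=> C Cinv CA z0 Cz0; exists C.
Qed.

(* Main.v *)
Require Import Defs.
From HB Require Import structures.
From mathcomp Require Import all_boot all_order all_algebra.
From mathcomp Require Import all_classical all_reals all_analysis.
From mathcomp Require Import ring lra.
Import numFieldNormedType.Exports.
Import Order.TTheory GRing.Theory Num.Theory.
Local Open Scope classical_set_scope.
Local Open Scope ring_scope.

(** Along a solution the energy [V] decreases at the rate
[omega^T D omega + (kappa / tau) |P (f - f_s)|^2]: the power exchanged between
the kinetic and the potential part cancels, and the control term pairs [f - f_s]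
with its own projection ([energy_rate]).  This holds on every time set, with
one-sided derivatives at end points, since the chain rule does.

The limits are obtained by Barbalat's lemma instead of an analysis of omega-limit
sets.  On a trajectory that stays in [K] every coordinate is bounded and, the
vector field being bounded too, Lipschitz; hence so is the dissipation, which is
a polynomial in the coordinates and their sines.  As [V] is monotone and bounded
below, it converges, so its derivative tends to zero: [omega -> 0] and
[P (f - f_s) -> 0].  A second application, to [omega], gives [omega' -> 0], and
the swing equation then yields [B (f - f_s) -> 0] ([nodal_mismatch_vanishes]).
The pair [(P x, B x)] determines [x] linearly ([ker_proj_reconstruct]), whence
[f -> f_s], and inverting the sine on the phase domain gives
[eta -> prv eta_s] ([flow_reflects_limit]).

The sine only sees phases modulo 2 pi, so the equilibrium in the phase domain is
the principal representative [prv eta_s] of the target.  Its singleton is an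
invariant set because no other global solution passes through it, forward or
backward in time ([swing_equilibrium_unique], by a Gronwall estimate).  It
therefore lies in the largest invariant set [L], and the distance to [L] tends
to zero by continuity.  Conversely, a point of [L] carries a solution with
[omega = 0] throughout, hence in nodal balance ([rest_balanced]), so its flow is
[f_s]. *)

Set Implicit Arguments.
Unset Strict Implicit.
Unset Printing Implicit Defensive.

(** * Derivatives relative to a time set *)

Lemma cvg_congr {T : Type} {U : topologicalType} {F : set_system T}
    {FF : Filter F} (f g : T -> U) (l : U) :
  (\forall x \near F, f x = g x) -> f x @[x --> F] --> l ->
  g x @[x --> F] --> l.
Proof. by move=> fg; apply: cvg_trans; exact: near_eq_cvg. Qed.

Lemma derivative_within_entry (R : realType) (k l : nat) (I : set R)
    (g : R -> 'M[R]_(k, l)) (t : R) (v : 'M[R]_(k, l)) i j :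
  derivative_within I g t v ->
  derivative_within I (fun s => g s i j : R^o) t (v i j).
Proof.
move=> dg; rewrite /derivative_within.
apply: (cvg_congr (f := fun h => (h^-1 *: (g (h + t) - g t)) i j)).
  by near=> h; rewrite !mxE.
exact: (cvg_comp _ _ dg (@coord_continuous R k l i j v)).
Unshelve. all: by end_near. Qed.

Lemma derivative_within_cst (R : realType) (V : normedModType R) (I : set R)
    (t : R) (c : V) : derivative_within I (fun=> c) t 0.
Proof.
rewrite /derivative_within; under eq_fun do rewrite subrr scaler0.
exact: cvg_cst.
Qed.

Section scalar_calculus.
Context {R : realType} (I : set R) (t : R).
Implicit Types f g : R -> R^o.

Lemma derivative_within_continuous g (b : R) : derivative_within I g t b ->
  g (h + t) @[h --> within [set h | I (h + t)] 0^'] --> g t.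
Proof.
move=> dg.
have id0 : h @[h --> within [set h | I (h + t)] 0^'] --> (0 : R).
  by apply: cvg_within_filter; exact: nbhs_dnbhs.
apply: (cvg_congr (f := fun h => g t + h * (h^-1 *: (g (h + t) - g t)))).
  rewrite near_withinE; near=> h => _.
  have h0 : h != 0 by near: h; exact: nbhs_dnbhs_neq.
  by rewrite /GRing.scale /= mulrA divff // mul1r addrC subrK.
rewrite -[X in _ --> X]addr0; apply: cvgD; first exact: cvg_cst.
by have q0 := cvgM id0 dg; rewrite mul0r in q0; exact: q0.
Unshelve. all: by end_near. Qed.

Lemma derivative_withinD f g (a b : R) :
  derivative_within I f t a -> derivative_within I g t b ->
  derivative_within I (fun s => f s + g s : R^o) t (a + b).
Proof.
move=> df dg; rewrite /derivative_within.
apply: (cvg_congr (f := fun h => h^-1 *: (f (h + t) - f t) +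
                                 h^-1 *: (g (h + t) - g t))); last exact: cvgD.
by near=> h; rewrite -scalerDr; congr (_ *: _); rewrite opprD addrACA.
Unshelve. all: by end_near. Qed.

Lemma derivative_within_sum k (g : 'I_k -> R -> R^o) (b : 'I_k -> R) :
  (forall i, derivative_within I (g i) t (b i)) ->
  derivative_within I (fun s => \sum_i g i s : R^o) t (\sum_i b i).
Proof.
elim: k g b => [|k IH] g b dg.
  under eq_fun do rewrite big_ord0.
  by rewrite big_ord0; exact: derivative_within_cst.
under eq_fun do rewrite big_ord_recl.
rewrite big_ord_recl.
exact: (derivative_withinD (dg ord0) (IH _ _ (fun i => dg (lift ord0 i)))).
Qed.

(** The chain rule holds along any relative filter because the difference
quotient of the outer function extends continuously to the base point. *)
Lemma derivative_within_comp (phi : R -> R) g (b d : R) :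
  derivative_within I g t b -> is_derive (g t : R) (1 : R) phi d ->
  derivative_within I (fun s => phi (g s) : R^o) t (d * b).
Proof.
move=> dg /is_derive1_caratheodory[q [phiE qc <-]].
have gt := derivative_within_continuous dg.
rewrite /derivative_within.
apply: (cvg_congr (f := fun h =>
  q (g (h + t)) * (h^-1 *: (g (h + t) - g t)))); last first.
  by apply: (cvgM _ dg); exact: (cvg_comp _ _ gt qc).
near=> h.
by rewrite /GRing.scale /= phiE; ring.
Unshelve. all: by end_near. Qed.

Lemma derivative_within_is_derive g (b : R) : nbhs t I ->
  derivative_within I g t b -> is_derive t (1 : R) g b.
Proof.
move=> It dg.
have dg' : h^-1 *: (g (h *: (1 : R) + t) - g t) @[h --> 0^'] --> (b : R^o).
  (* [I] fills a neighbourhood of [t], so small increments stay in [I]. *)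
  have sub : (0 : R)^' `=>` within [set h | I (h + t)] 0^'.
    move=> A; rewrite /within /= => hA.
    have hI : \forall h \near (0 : R)^', I (h + t).
      apply: nbhs_dnbhs.
      have : (h + t) @[h --> (0 : R)] --> t.
        rewrite -[X in _ --> X]add0r; apply: cvgD; [exact: cvg_id|exact: cvg_cst].
      exact.
    by near=> h; apply: (near hA h) => //; near: h.
  apply: (cvg_congr (f := fun h => h^-1 *: (g (h + t) - g t))).
    by near=> h; rewrite /GRing.scale /= mulr1.
  by move=> A /dg /sub.
apply: DeriveDef; first by apply/cvg_ex; exists b.
exact: cvg_lim dg'.
Unshelve. all: by end_near. Qed.

End scalar_calculus.

(** * Real functions at infinity *)

Section asymptotics.
Context {R : realType}.
Implicit Types g dg : R -> R.

Lemma mean_value g dg (s t : R) : s < t ->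
  (forall x, s <= x <= t -> is_derive x (1 : R) g (dg x)) ->
  exists2 c, s < c < t & g t - g s = dg c * (t - s).
Proof.
move=> st dgP.
have [|||c] := @MVT R g dg s t => //; last 1 first.
- by rewrite in_itv /= => cst gE; exists c.
- by move=> x; rewrite in_itv /= => /andP[/ltW sx /ltW xt]; apply: dgP; rewrite sx.
- apply: derivable_within_continuous => x; rewrite in_itv /= => /dgP xd.
  exact: ex_derive.
Qed.

Lemma nonincreasing_bounded_cvgy g (C : R) :
  (forall s t, 0 < s -> s < t -> g t <= g s) ->
  (forall t, 0 < t -> C <= g t) ->
  exists l : R, g t @[t --> +oo] --> l.
Proof.
move=> gdec gC.
have hi : has_inf [set g t | t in [set t | 0 < t]].
  split; first by exists (g 1), 1; rewrite /= ?ltr01.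
  by exists C => _ [t t0 <-]; exact: gC.
exists (inf [set g t | t in [set t | 0 < t]]).
apply/cvgrPdist_le => e e0.
have [_ [s s0 <-] gs] := inf_adherent e0 hi.
near=> t.
have st : s < t by near: t; apply: nbhs_pinfty_gt; exact: num_real.
have lt : inf [set g t | t in [set t | 0 < t]] <= g t.
  by apply: ge_inf; [exact: hi.2|exists t => //=; exact: lt_trans st].
rewrite distrC ger0_norm ?subr_ge0 // lerBlDl.
by apply: le_trans (ltW gs); exact: gdec.
Unshelve. all: by end_near. Qed.

(** Barbalat's lemma: over a window of length [h] the increment of a convergent
function tends to [0] and equals [h] times the derivative at some point of the
window, which is [L h]-close to the derivative at its left end. *)
Lemma barbalat g dg (l L : R) :
  (forall t : R, 0 < t -> is_derive t (1 : R) g (dg t)) ->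
  (forall s t, 0 < s -> 0 < t -> `|dg s - dg t| <= L * `|s - t|) ->
  g t @[t --> +oo] --> l -> dg t @[t --> +oo] --> 0.
Proof.
move=> gd dgL gl; apply/cvgrPdist_le => e e0.
have L0 : 0 <= L.
  have := le_trans (normr_ge0 _) (dgL 1 2 _ _).
  rewrite (_ : 1 - 2 = -1); last by lra.
  by rewrite normrN normr1 mulr1; apply.
(* The window is short enough for the derivative to vary by at most [e / 2]. *)
pose h := e / (2 * (L + 1)).
have h0 : 0 < h by rewrite divr_gt0 // mulr_gt0 //; lra.
have hL : L * h <= e / 2.
  rewrite /h (_ : L * (e / _) = e / 2 * (L / (L + 1))); last first.
    by field; rewrite lt0r_neq0 //; lra.
  by rewrite ler_piMr ?ler_pdivrMr; lra.
have q0 : 0 < e / 2 * h / 2 by rewrite divr_gt0 // mulr_gt0 // divr_gt0.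
have /cvgrPdist_le/(_ _ q0)[T [_ gT]] := gl.
near=> t.
have tT : T < t by near: t; apply: nbhs_pinfty_gt; exact: num_real.
have t0 : 0 < t by near: t; apply: nbhs_pinfty_gt; exact: num_real.
have [||c /andP[tc ch] gE] := @mean_value g dg t (t + h); first by rewrite ltrDl.
  by move=> x /andP[tx _]; apply: gd; exact: lt_le_trans tx.
have g1 := gT _ tT; have g2 := gT (t + h) _.
have {}g2 : `|l - g (t + h)| <= e / 2 * h / 2 by apply: g2; lra.
have gi : `|g (t + h) - g t| <= e / 2 * h.
  rewrite (_ : g (t + h) - g t = (l - g t) - (l - g (t + h))); last by lra.
  by apply: le_trans (ler_normB _ _) _; lra.
have dc : `|dg c| <= e / 2.
  move: gi; rewrite gE (_ : t + h - t = h); last by lra.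
  by rewrite normrM (gtr0_norm h0) ler_pM2r.
have dtc : `|dg t - dg c| <= e / 2.
  apply: le_trans (dgL _ _ _ _) _ => //; first exact: lt_trans tc.
  apply: le_trans hL; apply: ler_wpM2l => //.
  by rewrite distrC ger0_norm; lra.
rewrite sub0r normrN (_ : dg t = (dg t - dg c) + dg c); last by lra.
by apply: le_trans (ler_normD _ _) _; lra.
Unshelve. all: by end_near. Qed.

(** The weights [expR (- C t)] for [t > 0] and [expR (C t)] for [t < 0] make
the weighted function decrease away from time [0] in both directions; the growth
bound being two-sided, it controls the past as well as the future. *)
Lemma gronwall_eq0 g dg (C : R) : 
  (forall t : R, is_derive t (1 : R) g (dg t)) ->
  (forall t, 0 <= g t) -> (forall t, `|dg t| <= C * g t) ->
  g 0 = 0 -> forall t, g t = 0.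
Proof.
move=> gd g0 gC g00 t.
pose w k s := g s * expR (k * s).
have wd k s : is_derive s (1 : R) (w k) ((dg s + k * g s) * expR (k * s)).
  have gds := gd s; apply: is_derive_eq.
  by rewrite /GRing.scale /=; ring.
have w0 k : w k 0 = 0 by rewrite /w g00 mul0r.
have gw k : w k t <= 0 -> g t = 0.
  by rewrite /w pmulr_lle0 ?expR_gt0 // => gt0; apply/eqP; rewrite eq_le gt0 g0.
have [t0|t0|->//] := ltgtP t 0.
- apply: (gw C); rewrite -(w0 C) -subr_ge0.
  have [s _ ->] := mean_value t0 (fun x _ => wd C x).
  rewrite !mulr_ge0 ?expR_ge0 //; last by lra.
  by have := gC s; rewrite ler_norml => /andP[]; lra.
- apply: (gw (- C)); rewrite -(w0 (- C)) -subr_le0.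
  have [s _ ->] := mean_value t0 (fun x _ => wd (- C) x).
  rewrite mulr_le0_ge0 //; last by lra.
  rewrite mulr_le0_ge0 ?expR_ge0 //.
  by have := gC s; rewrite ler_norml => /andP[_]; lra.
Qed.

End asymptotics.

(** * Entrywise bounds, Lipschitz functions and limits *)

Section sup_bounds.
Context {R : realType}.

Definition entries_le k (x : 'cV[R]_k) (d : R) := forall i, `|x i 0| <= d.

Lemma entries_leD k (x y : 'cV[R]_k) (c d : R) :
  entries_le x c -> entries_le y d -> entries_le (x + y) (c + d).
Proof.
by move=> xc yd i; rewrite mxE; apply: le_trans (ler_normD _ _) (lerD _ _).
Qed.

Lemma mulmx_entries_le k l (A : 'M[R]_(l, k)) :
  exists2 C : R, 0 <= C &
    forall x d, entries_le x d -> entries_le (A *m x) (C * d).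
Proof.
exists (\sum_i \sum_j `|A i j|) => [|x d xd i].
  by apply: sumr_ge0 => i _; exact: sumr_ge0.
(* Without entries in [x] the bound [d] may be negative, but then [A *m x = 0]. *)
have [k0|[j0]] : (k = 0)%N \/ inhabited 'I_k.
- by case: k A x xd => [|k] *; [left|right; constructor; exact: ord0].
- subst k; rewrite mxE big_ord0 normr0.
  by under eq_bigr do rewrite big_ord0; rewrite big1 // mul0r.
have d0 : 0 <= d by apply: le_trans (xd j0).
rewrite mxE; apply: le_trans (ler_norm_sum _ _ _) _.
apply: (@le_trans _ _ (\sum_j `|A i j| * d)).
  by apply: ler_sum => j _; rewrite normrM ler_wpM2l.
rewrite -mulr_suml ler_wpM2r // [leRHS](bigD1 i) //= lerDl.
by apply: sumr_ge0 => i' _; exact: sumr_ge0.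
Qed.

Lemma lipschitz_of_derive (g dg : R -> R) (L : R) (s t : R) :
  (forall x, s <= x <= t \/ t <= x <= s -> is_derive x (1 : R) g (dg x)) ->
  (forall x, s <= x <= t \/ t <= x <= s -> `|dg x| <= L) ->
  `|g s - g t| <= L * `|s - t|.
Proof.
wlog st : s t / s <= t.
  move=> H gd gL; have [st|/ltW ts] := leP s t; first exact: H.
  rewrite distrC (distrC s); apply: H => // x xst.
    by apply: gd; case: xst; [right|left].
  by apply: gL; case: xst; [right|left].
move=> gd gL; move: st; rewrite le_eqVlt => /predU1P[->|st].
  by rewrite !subrr normr0 mulr0.
have [c /andP[sc ct] gE] := mean_value st (fun x xst => gd x (or_introl xst)).
rewrite distrC gE normrM (distrC s) ler_wpM2r //.
by apply: gL; left; rewrite !ltW.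
Qed.

Lemma sin_lipschitz (x y : R) : `|sin x - sin y| <= `|x - y|.
Proof.
rewrite -[leRHS]mul1r; apply: (lipschitz_of_derive (g := @sin R) (dg := @cos R)) => z _.
exact: cos_max.
Qed.

(** A class of derivatives to which Barbalat's lemma applies; boundedness is what
makes it stable under products. Time [0] is left out because solutions have
only one-sided derivatives there. *)
Definition bounded_lipschitz (g : R -> R) :=
  exists C : R, forall s t, 0 < s -> 0 < t ->
    `|g s| <= C /\ `|g s - g t| <= C * `|s - t|.

Lemma bounded_lipschitz_of_derive (g dg : R -> R) (C L : R) :
  (forall t : R, 0 < t -> is_derive t (1 : R) g (dg t)) ->
  (forall t, 0 < t -> `|g t| <= C) -> (forall t, 0 < t -> `|dg t| <= L) ->
  bounded_lipschitz g.
Proof.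
move=> gd gC gL; exists (`|C| + `|L|) => s t s0 t0; split.
  by apply: le_trans (gC s s0) _; apply: le_trans (ler_norm _) _; rewrite lerDl.
have pos x : s <= x <= t \/ t <= x <= s -> 0 < x.
  by case=> /andP[+ _]; exact: lt_le_trans.
apply: (lipschitz_of_derive (dg := dg)) => x /pos x0; first exact: gd.
by apply: le_trans (gL x x0) _; apply: le_trans (ler_norm _) _; rewrite lerDr.
Qed.

Lemma bounded_lipschitz_cst (c : R) : bounded_lipschitz (fun=> c).
Proof.
exists `|c| => s t _ _; split=> //.
by rewrite subrr normr0 mulr_ge0.
Qed.

Lemma bounded_lipschitzD f g : bounded_lipschitz f -> bounded_lipschitz g ->
  bounded_lipschitz (fun t => f t + g t).
Proof.
move=> [C fC] [D gD]; exists (C + D) => s t s0 t0.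
have [f1 f2] := fC s t s0 t0; have [g1 g2] := gD s t s0 t0; split.
  by apply: le_trans (ler_normD _ _) _; exact: lerD.
rewrite opprD addrACA mulrDl.
by apply: le_trans (ler_normD _ _) _; exact: lerD.
Qed.

Lemma bounded_lipschitzM f g : bounded_lipschitz f -> bounded_lipschitz g ->
  bounded_lipschitz (fun t => f t * g t).
Proof.
move=> [C fC] [D gD]; exists (C * D + C * D) => s t s0 t0.
have [f1 f2] := fC s t s0 t0; have [g1 g2] := gD s t s0 t0.
have [f3 _] := fC t s t0 s0.
have C0 : 0 <= C by apply: le_trans f1.
have D0 : 0 <= D by apply: le_trans g1.
split; rewrite ?normrM.
  by apply: (le_trans (ler_pM _ _ f1 g1)) => //; rewrite lerDl mulr_ge0.
rewrite (_ : _ - _ = (f s - f t) * g s + f t * (g s - g t)); last by ring.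
apply: le_trans (ler_normD _ _) _; rewrite !normrM mulrDl; apply: lerD.
  by rewrite mulrAC; exact: ler_pM.
by rewrite -mulrA; exact: ler_pM.
Qed.

Lemma bounded_lipschitz_sum k (f : 'I_k -> R -> R) :
  (forall i, bounded_lipschitz (f i)) ->
  bounded_lipschitz (fun t => \sum_i f i t).
Proof.
elim: k f => [|k IH] f fb.
  under eq_fun do rewrite big_ord0; exact: bounded_lipschitz_cst.
under eq_fun do rewrite big_ord_recl.
by apply: bounded_lipschitzD => //; exact: (IH (fun i => f (lift ord0 i))).
Qed.

Lemma bounded_lipschitz_comp (phi g : R -> R) :
  (forall x, `|phi x| <= 1) -> (forall x y, `|phi x - phi y| <= `|x - y|) ->
  bounded_lipschitz g -> bounded_lipschitz (fun t => phi (g t)).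
Proof.
move=> phi1 phiL [C gC]; exists (C + 1) => s t s0 t0.
have [g1 g2] := gC s t s0 t0.
have C0 : 0 <= C by apply: le_trans g1.
split; first by apply: le_trans (phi1 _) _; rewrite lerDr.
apply: le_trans (phiL _ _) _; apply: le_trans g2 _.
by rewrite ler_wpM2r // lerDl.
Qed.

Definition bounded_lipschitz_mx k l (X : R -> 'M[R]_(k, l)) :=
  forall i j, bounded_lipschitz (fun t => X t i j).

Lemma bounded_lipschitz_mx_cst k l (A : 'M[R]_(k, l)) :
  bounded_lipschitz_mx (fun=> A).
Proof. by move=> i j; exact: bounded_lipschitz_cst. Qed.

Lemma bounded_lipschitz_mxD k l (X Y : R -> 'M[R]_(k, l)) :
  bounded_lipschitz_mx X -> bounded_lipschitz_mx Y ->
  bounded_lipschitz_mx (fun t => X t + Y t).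
Proof.
move=> XL YL i j; under eq_fun do rewrite mxE; exact: bounded_lipschitzD.
Qed.

Lemma bounded_lipschitz_mx_tr k l (X : R -> 'M[R]_(k, l)) :
  bounded_lipschitz_mx X -> bounded_lipschitz_mx (fun t => (X t)^T).
Proof. by move=> XL i j; under eq_fun do rewrite mxE. Qed.

Lemma bounded_lipschitz_mxM k l r (X : R -> 'M[R]_(k, l))
    (Y : R -> 'M[R]_(l, r)) :
  bounded_lipschitz_mx X -> bounded_lipschitz_mx Y ->
  bounded_lipschitz_mx (fun t => X t *m Y t).
Proof.
move=> XL YL i j; under eq_fun do rewrite mxE.
apply: (@bounded_lipschitz_sum l (fun h t => X t i h * Y t h j)) => h.
exact: bounded_lipschitzM.
Qed.

Lemma bounded_lipschitz_mx_sin k l (X : R -> 'M[R]_(k, l)) :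
  bounded_lipschitz_mx X ->
  bounded_lipschitz_mx (fun t => map_mx (@sin R) (X t)).
Proof.
move=> XL i j; under eq_fun do rewrite mxE.
exact: bounded_lipschitz_comp (@sin_max R) sin_lipschitz (XL i j).
Qed.

(** Convergence to zero in the form that passes through linear maps: one threshold
of time serves all entries. *)
Definition vanishes k (X : R -> 'cV[R]_k) :=
  forall e : R, 0 < e -> \forall t \near +oo, entries_le (X t) e.

Lemma vanishesD k (X Y : R -> 'cV[R]_k) :
  vanishes X -> vanishes Y -> vanishes (fun t => X t + Y t).
Proof.
move=> X0 Y0 e e0; have e20 : 0 < e / 2 by rewrite divr_gt0.
near=> t; rewrite [e]splitr; apply: entries_leD; near: t; [exact: X0|exact: Y0].
Unshelve. all: by end_near. Qed.

Lemma vanishes_mul k l (A : 'M[R]_(l, k)) (X : R -> 'cV[R]_k) :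
  vanishes X -> vanishes (fun t => A *m X t).
Proof.
move=> X0 e e0; have [C C0 AC] := mulmx_entries_le A.
have C1 : 0 < C + 1 by rewrite ltr_wpDl.
have d0 : 0 < e / (C + 1) by rewrite divr_gt0.
near=> t => i; have : entries_le (X t) (e / (C + 1)) by near: t; exact: X0.
move=> /AC/(_ i) AX; apply: le_trans AX _.
by rewrite mulrCA ler_piMr ?(ltW e0) // ler_pdivrMr // mul1r lerDl.
Unshelve. all: by end_near. Qed.

Lemma vanishes_entry k (X : R -> 'cV[R]_k) :
  vanishes X <-> forall i, X t i 0 @[t --> +oo] --> (0 : R).
Proof.
split=> [X0 i|X0 e e0].
  apply/cvgrPdist_le => e e0; near=> t; rewrite sub0r normrN.
  by move: (i); near: t; exact: X0.
apply: filter_forall => i.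
have /cvgrPdist_le/(_ _ e0) := X0 i.
by apply: filterS => t; rewrite sub0r normrN.
Unshelve. all: by end_near. Qed.

Lemma vanishes_cvg k (X : R -> 'cV[R]_k) (l : 'cV[R]_k) :
  vanishes (fun t => X t - l) -> X t @[t --> +oo] --> l.
Proof.
move=> X0; apply/cvgrPdist_le => e e0; near=> t.
have Xe : entries_le (X t - l) e by near: t; exact: X0.
rewrite [leLHS]mx_normrE; apply: bigmax_le => [|[i j] _ /=]; first exact: ltW.
by have := Xe i; rewrite (ord1 j) -normrN !mxE opprB.
Unshelve. all: by end_near. Qed.

End sup_bounds.

(** * Quadratic forms and the projection onto the cycle space *)

Section weighted_forms.
Context {R : realType}.

Lemma bilin_posdiagE k (A : 'M[R]_k) (x y : 'cV[R]_k) : posdiag A ->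
  bilin A x y = \sum_i A i i * (x i 0 * y i 0).
Proof.
case=> /diag_mxP[d ->] _; rewrite /bilin mul_mx_diag mxE.
by apply: eq_bigr => i _; rewrite !mxE eqxx mulr1n; ring.
Qed.

Lemma bilin_ge0 k (A : 'M[R]_k) (x : 'cV[R]_k) : posdiag A -> 0 <= bilin A x x.
Proof.
move=> Apos; rewrite bilin_posdiagE //; apply: sumr_ge0 => i _.
by rewrite -expr2 mulr_ge0 ?sqr_ge0 // ltW //; exact: Apos.2.
Qed.

Lemma wnorm_sqr m (S : 'M[R]_m) (x : 'cV[R]_m) : posdiag S ->
  wnorm S x ^+ 2 = bilin (invmx S) x x.
Proof.
by move=> /posdiag_invmx[_ Spos]; rewrite sqr_sqrtr // bilin_ge0.
Qed.

Lemma vanishes_bilin k (A : 'M[R]_k) (X : R -> 'cV[R]_k) : posdiag A ->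
  bilin A (X t) (X t) @[t --> +oo] --> (0 : R) -> vanishes X.
Proof.
move=> Apos AX; apply/vanishes_entry => i; apply/cvgrPdist_le => e e0.
have Ai0 := Apos.2 i.
have q0 : 0 < A i i * e ^+ 2 by rewrite mulr_gt0 ?exprn_gt0.
have /cvgrPdist_le/(_ _ q0) := AX.
apply: filterS => t; rewrite !sub0r !normrN ger0_norm ?bilin_ge0 // => le_e.
rewrite -(ler_pXn2r (ltn0Sn 1)) ?nnegrE ?(ltW e0) //.
rewrite real_normK ?num_real // -(ler_pM2l Ai0); apply: le_trans le_e.
rewrite bilin_posdiagE // (bigD1 i) //= -expr2 lerDl sumr_ge0 // => j _.
by rewrite -expr2 mulr_ge0 ?sqr_ge0 // ltW //; exact: Apos.2.
Qed.

Variables (n m : nat) (B : 'M[R]_(n, m)) (S : 'M[R]_m).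
Hypothesis Spos : posdiag S.
Local Notation P := (ker_proj B S).

(** The residual [x - P x] is orthogonal to [ker B], in which [P x] lies. *)
Lemma bilin_ker_proj (x : 'cV[R]_m) :
  bilin (invmx S) x (P *m x) = wnorm S (P *m x) ^+ 2.
Proof.
have [BP _ orth] := ker_projP B x Spos.
rewrite wnorm_sqr //; apply/eqP; rewrite -subr_eq0 -(orth _ BP).
by rewrite /bilin linearB /= !mulmxBl !mxE.
Qed.

(** A cycle component and a nodal divergence together determine an edge vector:
a vector of [ker B] is its own projection. *)
Lemma ker_proj_inj (x : 'cV[R]_m) : P *m x = 0 -> B *m x = 0 -> x = 0.
Proof.
by move=> Px Bx; have [_ /(_ Bx) <- _] := ker_projP B x Spos.
Qed.

(** Injectivity of [x |-> (P x, B x)] is made quantitative by a linear left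
inverse. *)
Lemma ker_proj_reconstruct : exists G H,
  forall x : 'cV[R]_m, x = G *m (P *m x) + H *m (B *m x).
Proof.
have : row_full (col_mx P B).
  (* Every column of the cokernel matrix is killed by both [P] and [B]. *)
  rewrite -cokermx_eq0;
  move: (cokermx _) (mulmx_coker (col_mx P B)) => C; rewrite mul_col_mx => AC.
  have PC : P *m C = 0 by rewrite -[LHS](col_mxKu _ (B *m C)) AC linear0.
  have BC : B *m C = 0 by rewrite -[LHS](col_mxKd (P *m C)) AC linear0.
  apply/eqP/matrixP => i j; have := @ker_proj_inj (col j C).
  rewrite colE !mulmxA PC BC !mul0mx -colE => /(_ erefl erefl)/colP/(_ i).
  by rewrite !mxE.
case/row_fullP => K KE.
exists (lsubmx K), (rsubmx K) => x.
by rewrite !mulmxA -mulmxDl -mul_row_col hsubmxK KE mul1mx.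
Qed.

Lemma vanishes_ker_proj (X : R -> 'cV[R]_m) :
  vanishes (fun t => P *m X t) -> vanishes (fun t => B *m X t) -> vanishes X.
Proof.
have [G [H GH]] := ker_proj_reconstruct.
move=> PX BX.
have -> : X = fun t => G *m (P *m X t) + H *m (B *m X t).
  by apply/funext => t; exact: GH.
by apply: vanishesD; exact: vanishes_mul.
Qed.

End weighted_forms.

(** * The sine flow law *)

Section flow_law.
Context {R : realType} {m : nat} (a : 'rV[R]_m).

Lemma flowE (eta : 'cV[R]_m) e : flow a eta e 0 = a 0 e * sin (eta e 0).
Proof. by rewrite /flow mul_diag_mx !mxE. Qed.

Lemma flowBE (x y : 'cV[R]_m) e :
  (flow a x - flow a y) e 0 = a 0 e * (sin (x e 0) - sin (y e 0)).
Proof. by rewrite mxE [X in _ + X]mxE !flowE mulrBr. Qed.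

Lemma sin_pr (x : R) : sin (pr x) = sin x.
Proof.
rewrite /pr; set k := Num.floor _.
have sinDn (y : R) (j : nat) : sin (y + 2 * pi * j%:R) = sin y.
  elim: j => [|j IH]; first by rewrite mulr0 addr0.
  rewrite (_ : y + _ = y + 2 * pi * j%:R + pi *+ 2) ?sinD2pi //.
  by rewrite -natr1 -mulr_natr; ring.
case: k => j; first by rewrite -[LHS](sinDn _ j) subrK.
by rewrite NegzE mulrNz mulrN opprK sinDn.
Qed.

Lemma flow_prv (eta : 'cV[R]_m) : flow a (prv eta) = flow a eta.
Proof. by apply/colP => e; rewrite !flowE mxE sin_pr. Qed.

Lemma pr_id (x : R) : `|x| < pi / 2 -> pr x = x.
Proof.
move=> xpi; rewrite /pr (_ : Num.floor _ = 0) ?mulr0 ?subr0 //.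
have pi0 := pi_gt0 R; move: xpi; rewrite ltr_norml => /andP[x1 x2].
apply: floor_def; rewrite add0r ler_pdivlMr ?ltr_pdivrMr ?mulr_gt0 //.
by apply/andP; split; lra.
Qed.

Hypothesis apos : forall e, 0 < a 0 e.

Lemma phase_in_itv (eta : 'cV[R]_m) e : phase_domain (R:=R) (m:=m) eta ->
  eta e 0 \in `[- (pi / 2), pi / 2].
Proof. by move=> /(_ e) /ltW; rewrite ler_norml in_itv. Qed.

Lemma flow_inj : {in phase_domain (R:=R) (m:=m) &, injective (flow a)}.
Proof.
move=> x y; rewrite !inE => xD yD /colP xy; apply/colP => e.
have := xy e; rewrite !flowE => /(mulfI (lt0r_neq0 (apos e))).
by apply: sin_inj; exact: phase_in_itv.
Qed.

(** The inverse sine is continuous at the target because the latter stays away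
from the boundary of the phase domain. *)
Lemma flow_reflects_limit (X : R -> 'cV[R]_m) (l : 'cV[R]_m) :
  (forall t, 0 <= t -> phase_domain (R:=R) (m:=m) (X t)) ->
  phase_domain (R:=R) (m:=m) l ->
  vanishes (fun t => flow a (X t) - flow a l) ->
  vanishes (fun t => X t - l).
Proof.
move=> XD lD /vanishes_entry fX; apply/vanishes_entry => e.
have sX : sin (X t e 0) @[t --> +oo] --> sin (l e 0).
  have lim := cvgD (cvgM (cvg_cst (a 0 e)^-1) (fX e)) (cvg_cst (sin (l e 0))).
  rewrite mulr0 add0r in lim; 
  apply: (cvg_congr (f := fun t =>
    (a 0 e)^-1 * (flow a (X t) - flow a l) e 0 + sin (l e 0))); last exact: lim.
  near=> t; rewrite flowBE.
  by rewrite mulKf ?subrK // lt0r_neq0.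
have aX : asin (sin (X t e 0)) @[t --> +oo] --> asin (sin (l e 0)).
  apply: (cvg_comp _ _ sX); apply: continuous_asin.
  rewrite -ltr_norml lt_neqAle sin_max andbT norm_sin_eq1.
  by rewrite gt_eqF // cos_gt0_pihalf // -ltr_norml; exact: lD.
rewrite sinK ?phase_in_itv // in aX.
have lim := cvgD aX (cvg_cst (- l e 0)).
rewrite subrr in lim; 
apply: (cvg_congr (f := fun t => asin (sin (X t e 0)) - l e 0)); last exact: lim.
near=> t; rewrite sinK ?[RHS]mxE ?[X in _ = _ + X]mxE //.
apply: phase_in_itv.
by apply: XD; near: t; apply: nbhs_pinfty_ge; exact: num_real.
Unshelve. all: by end_near. Qed.

End flow_law.

(** * Swing dynamics *)

Section swing_dynamics.
Context {R : realType} {n m : nat} (B : 'M[R]_(n, m)) (M D : 'M[R]_n).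
Context (a : 'rV[R]_m) (S : 'M[R]_m) (kappa tau : R) (eta_s : 'cV[R]_m).
Hypothesis Mpos : posdiag M.
Hypothesis Dpos : posdiag D.
Hypothesis Spos : posdiag S.
Hypothesis apos : forall e, 0 < a 0 e.
Hypothesis kappa0 : 0 < kappa.
Hypothesis tau0 : 0 < tau.

Local Notation P := (ker_proj B S).
Local Notation f := (flow a).
Local Notation fs := (flow a eta_s).
Local Notation state := ('cV[R]_m * 'cV[R]_n)%type.
Local Notation sol := (swing_solution B M D a (B *m fs) S kappa tau fs).
Local Notation V := (bregman_energy M a eta_s fs).

(** The right-hand sides solved for the derivatives, each a linear map of the
frequency plus a linear map of the flow mismatch, so that one growth estimate
covers both. *)
Definition phase_velocity (y : state) : 'cV[R]_m :=
  B^T *m y.2 + (- (kappa / tau) *: (invmx S *m P)) *m (f y.1 - fs).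

Definition acceleration (y : state) : 'cV[R]_n :=
  - (invmx M *m D) *m y.2 + - (invmx M *m B) *m (f y.1 - fs).

Lemma inertia_acceleration (y : state) :
  M *m acceleration y = - (D *m y.2) - B *m (f y.1 - fs).
Proof.
have [Munit _] := posdiag_invmx Mpos.
by rewrite mulmxDr !mulNmx !mulmxN !mulmxA mulmxV // !mul1mx.
Qed.

Lemma swing_solution_velocity (I : set R) (z : R -> state) (t : R) :
  sol I z -> I t ->
  derivative_within I (fun s => (z s).1) t (phase_velocity (z t)) /\
  derivative_within I (fun s => (z s).2) t (acceleration (z t)).
Proof.
have [Munit _] := posdiag_invmx Mpos.
move=> zsol It; have [d1 [w d2 wE]] := zsol t It; split.
  by move: d1; rewrite /phase_velocity -scalemxAl scaleNr mulmxA.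
suff -> : acceleration (z t) = w by [].
rewrite -[LHS](mulKmx Munit) -[RHS](mulKmx Munit) inertia_acceleration.
congr (_ *m _); move/(congr1 (fun x => x - D *m (z t).2)): wE.
by rewrite addrK => ->; rewrite mulmxBr opprB addrC.
Qed.

Lemma bregman_energy_derivative (I : set R) (z : R -> state) (t : R) v w :
  derivative_within I (fun s => (z s).1) t v ->
  derivative_within I (fun s => (z s).2) t w ->
  derivative_within I (V \o z : R -> R^o) t
    (bilin M (z t).2 w + ((f (z t).1 - fs)^T *m v) 0 0).
Proof.
move=> dv dw.
(* [M] being diagonal, the energy is a sum of functions of one coordinate. *)
pose phi e (x : R) := a 0 e * (1 - cos x) - fs e 0 * (x - eta_s e 0).
pose psi i (x : R) := 2^-1 * M i i * x ^+ 2.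
have -> : V \o z = (fun s => \sum_i psi i ((z s).2 i 0) +
    (\sum_e phi e ((z s).1 e 0) + - potential a eta_s)).
  apply/funext => s; rewrite /= /bregman_energy bilin_posdiagE // mulr_sumr.
  rewrite /phi sumrB /potential -!addrA; congr (_ + _).
    by apply: eq_bigr => i _; rewrite /psi -mulrA expr2.
  congr (_ + _); rewrite addrC; congr (- _ - _).
  by rewrite mxE; apply: eq_bigr => e _; rewrite !mxE.
have -> : bilin M (z t).2 w + ((f (z t).1 - fs)^T *m v) 0 0 =
    \sum_i (M i i * (z t).2 i 0) * w i 0 +
    (\sum_e (a 0 e * sin ((z t).1 e 0) - fs e 0) * v e 0 + 0).
  rewrite addr0 bilin_posdiagE // mxE; congr (_ + _); apply: eq_bigr => i _.
    by rewrite mulrA.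
  by rewrite mxE flowBE flowE mulrBr.
apply: derivative_withinD.
  apply: (derivative_within_sum (g := fun i s => psi i ((z s).2 i 0))) => i.
  apply: (derivative_within_comp (g := fun s => (z s).2 i 0)).
    exact: derivative_within_entry dw.
  apply: is_derive_eq; rewrite /GRing.scale /=; lra.
apply: derivative_withinD; last exact: derivative_within_cst.
apply: (derivative_within_sum (g := fun e s => phi e ((z s).1 e 0))) => e.
apply: (derivative_within_comp (g := fun s => (z s).1 e 0)).
  exact: derivative_within_entry dv.
apply: is_derive_eq; rewrite /GRing.scale /=; lra.
Qed.

Definition dissipation (y : state) : R :=
  bilin D y.2 y.2 + kappa / tau * wnorm S (P *m (f y.1 - fs)) ^+ 2.

Lemma dissipation_ge0 y : 0 <= dissipation y.
Proof.
by rewrite addr_ge0 ?bilin_ge0 // mulr_ge0 ?sqr_ge0 // divr_ge0 ?ltW.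
Qed.

(** The exchange terms [omega^T B (f - fs)] between kinetic and potential energy
cancel, and orthogonality of the projection turns the remaining pairing into a
square. *)
Lemma energy_rate (y : state) :
  bilin M y.2 (acceleration y) + ((f y.1 - fs)^T *m phase_velocity y) 0 0 =
  - dissipation y.
Proof.
rewrite /dissipation -bilin_ker_proj // /bilin -mulmxA inertia_acceleration.
rewrite /phase_velocity; move: (f y.1 - fs) y.2 => x w.
have trE (u : 'M[R]_1) : u^T 0 0 = u 0 0 by rewrite mxE.
have addE (u v : 'M[R]_1) : (u + v) 0 0 = u 0 0 + v 0 0 by rewrite mxE.
have oppE (u : 'M[R]_1) : (- u) 0 0 = - u 0 0 by rewrite mxE.
have scaleE (c : R) (u : 'M[R]_1) : (c *: u) 0 0 = c * u 0 0 by rewrite mxE.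
have trC : x^T *m (B^T *m w) = (w^T *m (B *m x))^T.
  by rewrite !trmx_mul trmxK -mulmxA.
rewrite !mulmxDr trC !mulmxN -scalemxAl -scalemxAr !mulmxA.
by rewrite !(addE, oppE, scaleE, trE); ring.
Qed.

Lemma swing_energy_derivative (I : set R) (z : R -> state) (t : R) :
  sol I z -> I t ->
  derivative_within I (V \o z : R -> R^o) t (- dissipation (z t)).
Proof.
move=> zsol It; have [dv dw] := swing_solution_velocity zsol It.
by rewrite -energy_rate; exact: bregman_energy_derivative.
Qed.

(** Near an equilibrium phase the vector field is bounded by a multiple of the
distance to the equilibrium, because the sine is 1-Lipschitz. *)
Lemma vector_field_growth k (A : 'M[R]_(k, n)) (Q : 'M[R]_(k, m))
    (eta : 'cV[R]_m) : f eta = fs ->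
  exists2 C : R, 0 <= C & forall (y : state) d,
    entries_le (y.1 - eta) d -> entries_le y.2 d ->
    entries_le (A *m y.2 + Q *m (f y.1 - fs)) (C * d).
Proof.
move=> feta; have [C1 C10 AC] := mulmx_entries_le A.
have [C2 C20 QC] := mulmx_entries_le (Q *m diag_mx a).
exists (C1 + C2) => [|y d y1 y2]; first exact: addr_ge0.
rewrite mulrDl -feta /flow -mulmxBr mulmxA; apply: entries_leD; first exact: AC.
apply: QC => e; have := y1 e; rewrite !mxE; apply: le_trans.
exact: sin_lipschitz.
Qed.

(** The squared distance to the equilibrium grows at most at a rate proportional
to itself, by the growth estimate of the vector field. *)
Lemma swing_equilibrium_unique (eta : 'cV[R]_m) (z : R -> state) :
  f eta = fs -> sol setT z -> z 0 = (eta, 0) -> forall t, z t = (eta, 0).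
Proof.
move=> feta zsol z0.
pose dist t := \sum_e ((z t).1 e 0 - eta e 0) ^+ 2 + \sum_i (z t).2 i 0 ^+ 2.
pose ddist t :=
  \sum_e 2 * ((z t).1 e 0 - eta e 0) * phase_velocity (z t) e 0 +
  \sum_i 2 * (z t).2 i 0 * acceleration (z t) i 0.
have dE (t : R) : is_derive t (1 : R) dist (ddist t).
  have [dv dw] := swing_solution_velocity zsol (I : setT t).
  apply: (derivative_within_is_derive (I := setT)); first exact: filterT.
  apply: derivative_withinD.
    apply: (derivative_within_sum
      (g := fun e s => ((z s).1 e 0 - eta e 0) ^+ 2)) => e.
    apply: (derivative_within_comp (g := fun s => (z s).1 e 0)
      (phi := fun x => (x - eta e 0) ^+ 2)).
      exact: derivative_within_entry dv.
    apply: is_derive_eq; rewrite /GRing.scale /=; lra.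
  apply: (derivative_within_sum (g := fun i s => (z s).2 i 0 ^+ 2)) => i.
  apply: (derivative_within_comp (g := fun s => (z s).2 i 0)
    (phi := fun x => x ^+ 2)).
    exact: derivative_within_entry dw.
  apply: is_derive_eq; rewrite /GRing.scale /=; lra.
have sum0 (k : nat) (g : 'I_k -> R) : 0 <= \sum_i g i ^+ 2.
  by apply: sumr_ge0 => i _; exact: sqr_ge0.
have dist0 t : 0 <= dist t by exact: addr_ge0.
have coord (k : nat) (g : 'I_k -> R) (E : R) i :
    \sum_i g i ^+ 2 <= E -> `|g i| <= Num.sqrt E.
  move=> gE; rewrite -sqrtr_sqr ler_wsqrtr //; apply: le_trans gE.
  by rewrite (bigD1 i) //= lerDl sumr_ge0 // => j _; exact: sqr_ge0.
have c1 t : entries_le ((z t).1 - eta) (Num.sqrt (dist t)).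
  move=> e; rewrite !mxE.
  by apply: (coord _ (fun e => (z t).1 e 0 - eta e 0)); rewrite lerDl.
have c2 t : entries_le (z t).2 (Num.sqrt (dist t)).
  by move=> i; apply: (coord _ (fun i => (z t).2 i 0)); rewrite lerDr.
have [C1 _ v1] := @vector_field_growth m B^T (- (kappa / tau) *: (invmx S *m P)) _ feta.
have [C2 _ v2] := @vector_field_growth n (- (invmx M *m D)) (- (invmx M *m B)) _ feta.
have term (x y C E : R) : 0 <= E -> `|x| <= Num.sqrt E -> `|y| <= C * Num.sqrt E ->
    `|2 * x * y| <= 2 * C * E.
  move=> E0 xE yE; rewrite -mulrA -[in leRHS]mulrA normrM ger0_norm // ler_pM2l //.
  by rewrite normrM -[E in leRHS]sqr_sqrtr // expr2 mulrCA; exact: ler_pM.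
have sumk (k : nat) (g : 'I_k -> R) (c : R) : (forall i, `|g i| <= c) ->
    `|\sum_i g i| <= k%:R * c.
  move=> gc; apply: le_trans (ler_norm_sum _ _ _) _.
  apply: le_trans (ler_sum _ (fun i _ => gc i)) _.
  by rewrite sumr_const card_ord mulr_natl.
have ddist_le t : `|ddist t| <= (m%:R * (2 * C1) + n%:R * (2 * C2)) * dist t.
  apply: le_trans (ler_normD _ _) _; rewrite mulrDl -!mulrA !(mulrA 2).
  apply: lerD; apply: sumk => i; apply: term => //.
  - by have := c1 t i; rewrite !mxE.
  - exact: v1.
  - exact: c2.
  - exact: v2.
move=> t; have dt0 : dist t = 0.
  apply: (gronwall_eq0 dE dist0 ddist_le).
  rewrite /dist z0 /= big1 => [|e _]; last by rewrite subrr expr0n.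
  by rewrite big1 ?addr0 // => i _; rewrite mxE expr0n.
have := c1 t; have := c2 t; rewrite dt0 sqrtr0 => z2 z1.
rewrite [z t]surjective_pairing; congr pair; apply/colP => i.
  by have := z1 i; rewrite normr_le0 !mxE subr_eq0 => /eqP.
by have := z2 i; rewrite normr_le0 mxE => /eqP.
Qed.

Lemma swing_equilibrium (eta : 'cV[R]_m) (I : set R) :
  f eta = fs -> sol I (cst (eta, 0)).
Proof.
move=> feta t _ /=; rewrite feta subrr !mulmx0 scaler0 subr0 subrr; split.
  exact: derivative_within_cst.
by exists 0; [exact: derivative_within_cst|rewrite !mulmx0 addr0].
Qed.


(** Along a solution with vanishing frequency the acceleration vanishes too,
which is the nodal balance. *)
Lemma rest_balanced (z : R -> state) :
  sol setT z -> (forall t, (z t).2 = 0) -> B *m f (z 0).1 = B *m fs.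
Proof.
move=> zsol z2; have [_ [w dw wE]] := zsol 0 I.
have w0 : w = 0.
  apply/colP => i; rewrite mxE.
  have dwi : is_derive (0 : R) (1 : R) (fun s => (z s).2 i 0 : R^o) (w i 0).
    apply: (derivative_within_is_derive (I := setT)); first exact: filterT.
    exact: derivative_within_entry dw.
  rewrite -[LHS](@derive_val _ _ _ _ _ _ _ dwi).
  by under eq_fun do rewrite z2 mxE; rewrite derive_cst.
by move: wE; rewrite w0 z2 !mulmx0 addr0 => /esym/eqP; rewrite subr_eq0 => /eqP.
Qed.
(** * Convergence of bounded trajectories *)

Section bounded_trajectory.
Context (z : R -> state) (eta : 'cV[R]_m) (c : R).
Hypothesis zsol : sol half_line z.
Hypothesis zD : forall t, 0 <= t -> phase_domain (R:=R) (m:=m) (z t).1.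
Hypothesis zc : forall t, 0 <= t -> entries_le (z t).2 c.
Hypothesis etaE : f eta = fs.
Hypothesis etaD : phase_domain (R:=R) (m:=m) eta.

Let half_line_nbhs (t : R) : 0 < t -> nbhs t (half_line : set R).
Proof.
move=> t0; near=> s; rewrite /= in_itv /= andbT ltW //.
by near: s; exact: lt_nbhsr.
Unshelve. all: by end_near. Qed.

Let half_lineE (t : R) : 0 < t -> (half_line : set R) t.
Proof. by move=> t0; rewrite /= in_itv /= andbT ltW. Qed.

Let phase_is_derive e (t : R) : 0 < t ->
  is_derive t (1 : R) (fun s => (z s).1 e 0) (phase_velocity (z t) e 0).
Proof.
move=> t0; have [dv _] := swing_solution_velocity zsol (half_lineE t0).
apply: derivative_within_is_derive (half_line_nbhs t0) _.
exact: derivative_within_entry dv.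
Qed.

Let frequency_is_derive i (t : R) : 0 < t ->
  is_derive t (1 : R) (fun s => (z s).2 i 0) (acceleration (z t) i 0).
Proof.
move=> t0; have [_ dw] := swing_solution_velocity zsol (half_lineE t0).
apply: derivative_within_is_derive (half_line_nbhs t0) _.
exact: derivative_within_entry dw.
Qed.

Let displacement_le t : 0 < t ->
  entries_le ((z t).1 - eta) (pi + `|c|) /\ entries_le (z t).2 (pi + `|c|).
Proof.
move=> t0; split=> i.
  have := zD (ltW t0) i; have := etaD i; rewrite !mxE => e1 e2.
  by apply: le_trans (ler_normB _ _) _; have := normr_ge0 c; lra.
have := zc (ltW t0) i; have := ler_norm c; have := pi_gt0 R; lra.
Qed.

(** Bounded coordinates give bounded velocities, hence Lipschitz coordinates. *)
Lemma trajectory_bounded_lipschitz :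
  bounded_lipschitz_mx (fun t => (z t).1) /\
  bounded_lipschitz_mx (fun t => (z t).2).
Proof.
split=> i j; rewrite (ord1 j).
  have [C _ vC] := @vector_field_growth m B^T
    (- (kappa / tau) *: (invmx S *m P)) _ etaE.
  apply: (bounded_lipschitz_of_derive (phase_is_derive i)) => t t0.
    by apply: ltW; exact: (zD (ltW t0)).
  by have [d1 d2] := displacement_le t0; exact: vC _ _ d1 d2 i.
have [C _ vC] := @vector_field_growth n (- (invmx M *m D))
  (- (invmx M *m B)) _ etaE.
apply: (bounded_lipschitz_of_derive (frequency_is_derive i)) => t t0.
  exact: (zc (ltW t0)).
by have [d1 d2] := displacement_le t0; exact: vC _ _ d1 d2 i.
Qed.

Let mismatch_bounded_lipschitz :
  bounded_lipschitz_mx (fun t => f (z t).1 - fs).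
Proof.
apply: bounded_lipschitz_mxD; last exact: bounded_lipschitz_mx_cst.
apply: bounded_lipschitz_mxM; first exact: bounded_lipschitz_mx_cst.
by apply: bounded_lipschitz_mx_sin; case: trajectory_bounded_lipschitz.
Qed.

Let acceleration_bounded_lipschitz :
  bounded_lipschitz_mx (fun t => acceleration (z t)).
Proof.
have [_ zw] := trajectory_bounded_lipschitz.
by apply: bounded_lipschitz_mxD; apply: bounded_lipschitz_mxM => //;
   exact: bounded_lipschitz_mx_cst.
Qed.

Let dissipation_bounded_lipschitz :
  bounded_lipschitz (fun t => dissipation (z t)).
Proof.
have [_ zw] := trajectory_bounded_lipschitz.
have form k (A : 'M[R]_k) (X : R -> 'cV[R]_k) : bounded_lipschitz_mx X ->
    bounded_lipschitz (fun t => bilin A (X t) (X t)).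
  move=> XL; have tL := bounded_lipschitz_mx_tr XL.
  by apply: (bounded_lipschitz_mxM (bounded_lipschitz_mxM tL
    (bounded_lipschitz_mx_cst A)) XL).
apply: bounded_lipschitzD; first exact: form.
apply: bounded_lipschitzM; first exact: bounded_lipschitz_cst.
under eq_fun do rewrite wnorm_sqr //; apply: form.
by apply: bounded_lipschitz_mxM => //; exact: bounded_lipschitz_mx_cst.
Qed.

Let energy_is_derive (t : R) : 0 < t ->
  is_derive t (1 : R) (V \o z) (- dissipation (z t)).
Proof.
move=> t0; apply: derivative_within_is_derive (half_line_nbhs t0) _.
by apply: swing_energy_derivative zsol _; exact: half_lineE.
Qed.

Let energy_cvg : exists l : R, V (z t) @[t --> +oo] --> l.
Proof.
have [zv _] := trajectory_bounded_lipschitz.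
have /(_ 0 0)[C lC] : bounded_lipschitz_mx (fun t => fs^T *m ((z t).1 - eta_s)).
  apply: bounded_lipschitz_mxM; first exact: bounded_lipschitz_mx_cst.
  by apply: bounded_lipschitz_mxD => //; exact: bounded_lipschitz_mx_cst.
apply: (@nonincreasing_bounded_cvgy _ _ (- potential a eta_s - C)) => [s t s0 st|t t0].
  have [|x _ VE] := @mean_value _ (V \o z) (fun t => - dissipation (z t)) s t st.
    by move=> x /andP[sx _]; apply: energy_is_derive; exact: lt_le_trans sx.
  rewrite -subr_le0 [leLHS]VE mulNr oppr_le0.
  by rewrite mulr_ge0 ?dissipation_ge0 // subr_ge0 ltW.
have [lt _] := lC t t t0 t0.
have p0 : 0 <= potential a (z t).1.
  apply: sumr_ge0 => e _; rewrite mulr_ge0 ?subr_ge0 ?cos_le1 //.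
  exact: ltW.
have b0 := bilin_ge0 (z t).2 Mpos.
by move: lt; rewrite ler_norml /bregman_energy => /andP[_]; lra.
Qed.

Let dissipation_cvg0 : dissipation (z t) @[t --> +oo] --> (0 : R).
Proof.
have [l Vl] := energy_cvg; have [L dL] := dissipation_bounded_lipschitz.
have := barbalat (L := L) energy_is_derive _ Vl.
move=> lim; rewrite -oppr0; under eq_fun do rewrite -[dissipation _]opprK.
apply: cvgN; apply: lim => s t s0 t0.
by rewrite -opprB normrN opprK addrC; have [_] := dL s t s0 t0.
Qed.

(** The frequency form is one of the two nonnegative terms of the dissipation. *)
Lemma frequency_vanishes : vanishes (fun t => (z t).2).
Proof.
apply: (vanishes_bilin Dpos).
apply: (squeeze_cvgr _ (cvg_cst 0) dissipation_cvg0).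
near=> t; rewrite bilin_ge0 //= /dissipation lerDl.
by rewrite mulr_ge0 ?sqr_ge0 // divr_ge0 ?ltW.
Unshelve. all: by end_near. Qed.

Lemma cycle_mismatch_vanishes : vanishes (fun t => P *m (f (z t).1 - fs)).
Proof.
have [_ Sinv] := posdiag_invmx Spos; apply: (vanishes_bilin Sinv).
have lim : (kappa / tau)^-1 * dissipation (z t) @[t --> +oo] --> (0 : R).
  rewrite -[X in _ --> X](mulr0 (kappa / tau)^-1).
  by apply: cvgM => //; exact: cvg_cst.
apply: (squeeze_cvgr _ (cvg_cst 0) lim).
have k0 : 0 < kappa / tau by rewrite divr_gt0.
near=> t; rewrite bilin_ge0 //= -wnorm_sqr // /dissipation mulrDr mulKf ?gt_eqF //.
by rewrite lerDr mulr_ge0 ?bilin_ge0 // invr_ge0 ltW.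
Unshelve. all: by end_near. Qed.

(** The frequency tends to zero, and so does its derivative by a second use of
Barbalat's lemma; the swing equation then leaves no nodal imbalance. *)
Lemma nodal_mismatch_vanishes : vanishes (fun t => B *m (f (z t).1 - fs)).
Proof.
have acc0 : vanishes (fun t => acceleration (z t)).
  apply/vanishes_entry => i.
  have [L dL] := acceleration_bounded_lipschitz i 0.
  have /vanishes_entry/(_ i) w0 := frequency_vanishes.
  apply: (barbalat (L := L) (frequency_is_derive i) _ w0) => s t s0 t0.
  by have [_] := dL s t s0 t0.
have -> : (fun t => B *m (f (z t).1 - fs)) =
    fun t => (- M) *m acceleration (z t) + (- D) *m (z t).2.
  apply/funext => t; rewrite !mulNmx inertia_acceleration //.
  by rewrite opprB opprK addrK.
by apply: vanishesD; apply: vanishes_mul => //; exact: frequency_vanishes.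
Qed.

Lemma mismatch_vanishes : vanishes (fun t => f (z t).1 - fs).
Proof.
exact: (vanishes_ker_proj Spos cycle_mismatch_vanishes
  nodal_mismatch_vanishes).
Qed.

Lemma phase_vanishes : vanishes (fun t => (z t).1 - eta).
Proof.
apply: (flow_reflects_limit apos zD etaD); rewrite etaE.
exact: mismatch_vanishes.
Qed.

End bounded_trajectory.

End swing_dynamics.

(** * Bus phases and line actuators *)

Section gauge.
Context {R : realType} {n m : nat}.

Lemma derivative_within_shift (V : normedModType R) (I : set R) (g : R -> V)
    (t : R) (v c : V) :
  derivative_within I g t v -> derivative_within I (fun s => g s + c) t v.
Proof.
move=> dg; rewrite /derivative_within.
by under eq_fun do rewrite opprD addrACA subrr addr0.
Qed.

Lemma effective_phase_shift (B : 'M[R]_(n, m)) (theta d : 'cV[R]_n)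
    (u : 'cV[R]_m) :
  effective_phase B (theta + d) (u - B^T *m d) = effective_phase B theta u.
Proof. by rewrite /effective_phase mulmxDr -addrA [X in _ + X]addrC subrK. Qed.

Lemma closed_loop_shift (B : 'M[R]_(n, m)) (M D : 'M[R]_n) (a : 'rV[R]_m)
    (p : 'cV[R]_n) (S : 'M[R]_m) (kappa tau : R) (fs : 'cV[R]_m) (I : set R)
    (theta omega : R -> 'cV[R]_n) (u : R -> 'cV[R]_m) (d : 'cV[R]_n) :
  closed_loop_solution B M D a p S kappa tau fs I theta omega u ->
  closed_loop_solution B M D a p S kappa tau fs I
    (fun t => theta t + d) omega (fun t => u t - B^T *m d).
Proof.
move=> sol t It; rewrite effective_phase_shift.
have [dtheta domega [du duD duE]] := sol t It; split=> //.
  exact: derivative_within_shift.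
by exists du => //; exact: derivative_within_shift.
Qed.

Lemma incidence_const (tail head : 'I_m -> 'I_n) (c : R) :
  (incidence R tail head)^T *m const_mx c = 0 :> 'cV[R]_m.
Proof.
apply/colP => e; rewrite !mxE; under eq_bigr do rewrite !mxE.
rewrite -mulr_suml sumrB (bigD1 (tail e)) //= [X in _ - X](bigD1 (head e)) //=.
by rewrite !eqxx !big1 ?addr0 ?subrr ?mul0r // => i /negPf ->.
Qed.

(** The effective phase depends continuously on the pair, so it takes at every
limit point of the pair the value to which it converges along the trajectory. *)
Lemma cluster_effective_phase (B : 'M[R]_(n, m)) (theta : R -> 'cV[R]_n)
    (u : R -> 'cV[R]_m) (eta : 'cV[R]_m) (y : 'cV[R]_n * 'cV[R]_m) :
  vanishes (fun t => effective_phase B (theta t) (u t) - eta) ->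
  cluster ((theta t, u t) @[t --> +oo]) y -> effective_phase B y.1 y.2 = eta.
Proof.
move=> lim ycl; have [C C0 BC] := mulmx_entries_le B^T.
have C2 : 0 < C + 2 by rewrite ltr_wpDl.
have near_le e : 0 < e -> entries_le (effective_phase B y.1 y.2 - eta) e.
  move=> e0; pose d := e / (C + 2).
  have d0 : 0 < d by rewrite divr_gt0.
  have Fd : \forall w \near ((theta t, u t) @[t --> +oo]),
      entries_le (effective_phase B w.1 w.2 - eta) d by exact: lim.
  have [w [wd [[_ w1] [_ w2]]]] := ycl _ _ Fd (nbhsx_ballx y d d0).
  have -> : effective_phase B y.1 y.2 - eta = B^T *m (y.1 - w.1) + (y.2 - w.2) +
      (effective_phase B w.1 w.2 - eta).
    rewrite /effective_phase mulmxBr.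
    by apply/colP => i; rewrite !mxE; ring.
  have -> : e = C * d + d + d.
    by rewrite -[LHS](divfK (lt0r_neq0 C2)) -/d; ring.
  apply: entries_leD => //; apply: entries_leD; first apply: BC.
    by move=> i; rewrite !mxE ltW //; exact: w1.
  by move=> i; rewrite !mxE ltW //; exact: w2.
apply/colP => i; apply/eqP; rewrite -subr_eq0 -normr_le0.
apply/ler_addgt0Pr => e e0; rewrite add0r.
by have := near_le e e0 i; rewrite !mxE.
Qed.

End gauge.

(** * Convergence to the synchronous target *)

Theorem theorem12p15 (R : realType) (n m : nat) (tail head : 'I_m -> 'I_n)
    (M D : 'M[R]_n) (a : 'rV[R]_m) (S : 'M[R]_m) (kappa tau gamma : R)
    (p : 'cV[R]_n) (eta_s f_s : 'cV[R]_m)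
    (K : set ('cV[R]_m * 'cV[R]_n)) (z : R -> 'cV[R]_m * 'cV[R]_n) :
  let B : 'M[R]_(n, m) := incidence R tail head in
  let P := ker_proj B S in
  let f := flow a in
  let sol := swing_solution B M D a p S kappa tau f_s in
  let full_sol := closed_loop_solution B M D a p S kappa tau f_s in
  let V := bregman_energy M a eta_s f_s in
  connected_graph tail head ->
  posdiag M -> posdiag D -> posdiag S ->
  (forall e, 0 < a 0 e) ->
  0 < kappa -> 0 < tau ->
  f_s = f eta_s -> p = B *m f_s -> P *m f_s = 0 ->
  0 < gamma < pi / 2 -> (forall e, `|pr (eta_s e 0)| <= gamma) ->
  compact K -> K `<=` phase_domain (R:=R) (m:=m) `*` setT ->
  forward_invariant sol K ->
  sol half_line z -> (forall t, 0 <= t -> K (z t)) ->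
  (* energy dissipation *)
  (forall t, 0 <= t ->
     let rate := - bilin D (z t).2 (z t).2
                 - kappa / tau * wnorm S (P *m (f (z t).1 - f_s)) ^+ 2 in
     derivative_within half_line (V \o z : R -> R^o) t rate /\ rate <= 0) /\
  (* LaSalle set; A is the part of the effective state space in which the
     invariant set is formed: the whole space, phase_domain `*` setT, or K *)
  (forall A : set ('cV[R]_m * 'cV[R]_n), K `<=` A ->
     let L := largest_invariant sol
       (A `&` [set y | y.2 = 0 /\ P *m (f y.1 - f_s) = 0]) in
     [/\ edist_inf L (z t) @[t --> +oo] --> 0%E,
         forall y, L y -> y.2 = 0 /\ P *m (f y.1 - f_s) = 0,
         forall y, L y -> B *m f y.1 = p,
         forall y, L y -> f y.1 = f_s &
         A `<=` phase_domain (R:=R) (m:=m) `*` setT ->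
         L = [set (prv eta_s, 0)]]) /\
  (forall eta, P *m (f eta - f_s) = 0 -> B *m f eta = p -> f eta = f_s) /\
  {in phase_domain (R:=R) (m:=m) &, injective f} /\
  (* limits; the target is only constrained modulo 2 pi, and it coincides with
     its principal representative as soon as it lies in the phase domain *)
  [/\ f (z t).1 @[t --> +oo] --> f_s,
      (z t).1 @[t --> +oo] --> prv eta_s,
      (z t).2 @[t --> +oo] --> (0 : 'cV[R]_n) &
      phase_domain (R:=R) (m:=m) eta_s -> prv eta_s = eta_s] /\
  (* full closed-loop trajectories over the given effective trajectory *)
  (forall (theta omega : R -> 'cV[R]_n) (u : R -> 'cV[R]_m),
     full_sol half_line theta omega u ->
     (forall t, 0 <= t ->
        z t = (effective_phase B (theta t) (u t), omega t)) ->
     [/\ forall y : 'cV[R]_n * 'cV[R]_m,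
           cluster ((theta t, u t) @[t --> +oo]) y ->
           effective_phase B y.1 y.2 = prv eta_s,
         forall d : 'cV[R]_n,
           full_sol half_line (fun t => theta t + d) omega
                              (fun t => u t - B^T *m d) /\
           forall t, effective_phase B (theta t + d) (u t - B^T *m d) =
                     effective_phase B (theta t) (u t) &
         forall c : R,
           full_sol half_line (fun t => theta t + const_mx c) omega u /\
           forall t, effective_phase B (theta t + const_mx c) (u t) =
                     effective_phase B (theta t) (u t)]) /\
  (forall (theta0 : 'cV[R]_n) (u0 : 'cV[R]_m),
     effective_phase B theta0 u0 = prv eta_s ->
     full_sol setT (cst theta0) (cst 0) (cst u0)).

Proof.
move=> B P f sol full_sol V _ Mpos Dpos Spos apos kappa0 tau0 fsE pE _.
move=> /andP[_ gpi] eta_g Kc KD _ zsol zK; subst p f_s.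
pose eta0 := prv eta_s.
have eta0E : f eta0 = f eta_s by exact: flow_prv.
have eta0D : phase_domain (R:=R) (m:=m) eta0.
  by move=> e; rewrite mxE; exact: le_lt_trans (eta_g e) gpi.
have zD t : 0 <= t -> phase_domain (R:=R) (m:=m) (z t).1.
  by move=> /zK/KD[].
have [c zc] : exists c, forall t, 0 <= t -> entries_le (z t).2 c.
  have [c [_ Kb]] := compact_bounded Kc.
  exists (c + 1) => t /zK zt i; have := Kb (c + 1) _ _ zt.
  rewrite ltrDl ltr01 => /(_ isT); apply: le_trans.
  rewrite prod_normE le_max; apply/orP; right.
  rewrite [leRHS]mx_normrE.
  by rewrite (le_bigmax _ (fun ij : 'I_n * 'I_1 => `|(z t).2 ij.1 ij.2|) (i, 0)).
have zw := frequency_vanishes Mpos Dpos Spos apos kappa0 tau0 zsol zD zc eta0E eta0D.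
have zx := mismatch_vanishes Mpos Dpos Spos apos kappa0 tau0 zsol zD zc eta0E eta0D.
have phase0 := phase_vanishes Mpos Dpos Spos apos kappa0 tau0 zsol zD zc eta0E eta0D.
have {}zw : (z t).2 @[t --> +oo] --> (0 : 'cV[R]_n).
  by apply: vanishes_cvg; under eq_fun do rewrite subr0.
have {}zx := vanishes_cvg zx.
have zeta := vanishes_cvg phase0.
have zlim : z t @[t --> +oo] --> (eta0, 0 : 'cV[R]_n).
  have -> : z = fun t => ((z t).1, (z t).2).
    by apply/funext => t; exact: surjective_pairing.
  exact: (cvg_pair zeta zw).
have Keq : K (eta0, 0).
  have Kcl : closed K by apply: compact_closed Kc; exact: norm_hausdorff.
  apply: (closed_cvg _ Kcl _ _ zlim); near=> t; apply: zK.
  by near: t; apply: nbhs_pinfty_ge; exact: num_real.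
have balanced eta : P *m (f eta - f eta_s) = 0 -> B *m f eta = B *m f eta_s ->
    f eta = f eta_s.
  move=> Px Bx; apply/subr0_eq; apply: (ker_proj_inj (B := B) Spos Px).
  by rewrite mulmxBr Bx subrr.
have inj : {in phase_domain (R:=R) (m:=m) &, injective f} by exact: flow_inj.
split; [|split; [|split; [|split; [|split; [|split]]]]] => //.
- move=> t t0 /=; have tI : (half_line : set R) t by rewrite /= in_itv /= andbT.
  rewrite -opprD oppr_le0; split; last exact: dissipation_ge0.
  exact: swing_energy_derivative zsol tI.
- move=> A KA L; have [Linv LA _] := largest_invariantP sol
    (A `&` [set y | y.2 = 0 /\ P *m (f y.1 - f eta_s) = 0]).
  rewrite -/L in Linv LA.
  have Leq : L (eta0, 0).
    (* The singleton of the equilibrium is invariant and contained in [A]. *)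
    exists [set (eta0, 0)] => //; split.
      move=> _ ->; split; first by exists (cst (eta0, 0)) => //; exact: swing_equilibrium.
      move=> w wsol w0 t.
      exact: (swing_equilibrium_unique Mpos eta0E wsol w0).
    by move=> _ ->; split; [exact: KA|rewrite /= eta0E subrr mulmx0].
  have Lbal y : L y -> B *m f y.1 = B *m f eta_s.
    move=> Ly; have [[w wsol w0] wL] := Linv _ Ly.
    rewrite -w0; apply: (rest_balanced wsol) => t.
    by have /LA[_ []] := wL _ wsol w0 t.
  have Lflow y : L y -> f y.1 = f eta_s.
    by move=> Ly; have /LA[_ [_ Px]] := Ly; apply: balanced => //; exact: Lbal.
  split=> //.
  + rewrite -(edist_inf0 Leq).
    by apply: (cvg_comp _ _ zlim); exact: edist_inf_continuous.
  + by move=> y /LA[].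
  + move=> AD; apply/seteqP; split=> [y Ly|_ ->//].
    have [Ay [y2 _]] := LA _ Ly; have [y1D _] := AD _ Ay.
    rewrite /= [y]surjective_pairing y2; congr pair.
    by apply: inj; rewrite ?inE // Lflow.
- split=> //; move=> etaD; apply/colP => e; rewrite mxE.
  by apply: pr_id; exact: etaD.
- move=> theta omega u usol zE; split.
  + move=> y; apply: cluster_effective_phase => e e0; near=> t.
    have t0 : 0 <= t by near: t; apply: nbhs_pinfty_ge; exact: num_real.
    have := congr1 fst (zE t t0) => /= <-.
    by near: t; exact: phase0.
  + by move=> d; split=> [|t]; [exact: closed_loop_shift|exact: effective_phase_shift].
  + move=> c'; have BC := incidence_const tail head c'.
    split=> [|t]; last first.
      by rewrite -[RHS](effective_phase_shift B _ (const_mx c')) BC subr0.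
    have := closed_loop_shift (const_mx c') usol.
    by rewrite BC (_ : (fun t => u t - 0) = u) //; apply/funext => t; rewrite subr0.
- move=> theta0 u0 E t _ /=; rewrite E flow_prv; split.
  + exact: derivative_within_cst.
  + exists 0; first exact: derivative_within_cst.
    by rewrite !mulmx0 subr0 subrr.
  + exists 0; first exact: derivative_within_cst.
    by rewrite subrr !mulmx0 !scaler0.
Unshelve. all: by end_near.
Qed.
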